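(* Take $p,q$ such that $1<p\le q<\infty$. Suppose that either $2\le p\le q$, or that $1<p<2$ and $p\le q<p/(2-p)$. Then the multi-norms $(\|\cdot\|_n^{[q]}:n\in\mathbb N)$ and $(\|\cdot\|_n^{(p,q)}:n\in\mathbb N)$ based on $\ell^p$ are not equivalent.
   Context: $\ell^p=\ell^p(\mathbb N)$ is the usual complex Banach space. Standard $q$-multi-norm on $\ell^p$ ($q\ge p$): $\|(f_1,\dots,f_n)\|_n^{[q]}=\sup_{\mathbf X}\big(\sum_{i=1}^n\|f_i\chi_{X_i}\|_{\ell^p}^q\big)^{1/q}$, where the supremum is over all ordered partitions $\mathbf X=(X_1,\dots,X_n)$ of $\mathbb N$ into pairwise-disjoint subsets (some possibly empty). $(p,q)$-multi-norm on $E=\ell^p$: $\|(f_1,\dots,f_n)\|_n^{(p,q)}=\sup\{(\sum_{i=1}^n|\langle f_i,\lambda_i\rangle|^q)^{1/q}:\lambda_1,\dots,\lambda_n\in E',\ \mu_{p,n}(\lambda_1,\dots,\lambda_n)\le1\}$, where $\mu_{p,n}(\lambda_1,\dots,\lambda_n)=\sup\{(\sum_{j=1}^n|\langle f,\lambda_j\rangle|^p)^{1/p}:f\in E,\|f\|\le1\}$. Two multi-norms $(\|\cdot\|_n^1)$ and $(\|\cdot\|_n^2)$ based on a normed space $E$ are equivalent if there is a constant $C>0$ such that $\|x\|_n^1\le C\|x\|_n^2$ and $\|x\|_n^2\le C\|x\|_n^1$ for all $n\in\mathbb N$ and $x\in E^n$. *)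

(* Defs.v *)
From HB Require Import structures.
From mathcomp Require Import all_boot all_order all_algebra.
From mathcomp Require Import all_classical all_reals all_analysis.
From mathcomp Require Import complex.

Set Implicit Arguments.
Unset Strict Implicit.
Unset Printing Implicit Defensive.

Import Order.TTheory GRing.Theory Num.Theory ComplexField.Normc.

Local Open Scope classical_set_scope.
Local Open Scope complex_scope.
Local Open Scope ring_scope.

Section complex_modulus.
Context (R : realType).
Implicit Types z : R[i].

Lemma normcE z : `|z| = (normc z)%:C.
Proof. by rewrite normc_def; case: z. Qed.

Lemma normc_ge0 z : 0 <= normc z.
Proof. by case: z => a b; exact: sqrtr_ge0. Qed.

End complex_modulus.

Section lpnorm.
Context (R : realType).
Implicit Types (p : R) (f g : nat -> R[i]) (X : set nat).

Definition lpnorm p f : \bar R := 'N[counting]_p%:E [EFin \o (@normc R \o f)].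

Lemma lpnormE p f : 0 < p ->
  lpnorm p f = ((\sum_(k <oo) (normc (f k) `^ p)%:E) `^ p^-1)%E.
Proof.
move=> p0; rewrite /lpnorm Lnorm_counting//; congr (_ `^ _)%E.
by apply: eq_eseriesr => k _ /=; rewrite ger0_norm// normc_ge0.
Qed.

Lemma lpnorm_ge0 p f : (0 <= lpnorm p f)%E.
Proof. exact: Lnorm_ge0. Qed.

Lemma le_lpnorm p f g : 0 < p -> (forall k, normc (f k) <= normc (g k)) ->
  (lpnorm p f <= lpnorm p g)%E.
Proof.
move=> p0 fg; rewrite !lpnormE//.
have s0 h : (0 <= \sum_(k <oo) (normc (h k : R[i]) `^ p)%:E)%E.
  by apply: nneseries_ge0 => k _ _; rewrite lee_fin powR_ge0.
apply: gt0_ler_poweR; [by rewrite invr_ge0 ltW|by rewrite in_itv/= s0 leey..|].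
apply: lee_nneseries => [k _ _|k _]; rewrite lee_fin ?powR_ge0//.
by apply: ge0_ler_powR => //; rewrite ?nnegrE ?normc_ge0// ltW.
Qed.

Lemma lpnorm0 p : 0 < p -> lpnorm p (0 : nat -> R[i]) = 0%E.
Proof.
move=> p0; rewrite lpnormE// eseries0 ?poweR0r ?invr_neq0 ?gt_eqF// => k _ _.
by rewrite normc0 powR0 ?gt_eqF.
Qed.

Lemma lpnormD p f g : 1 <= p ->
  (lpnorm p (f + g)%R <= lpnorm p f + lpnorm p g)%E.
Proof.
move=> p1; have p0 : 0 < p by rewrite (lt_le_trans ltr01).
have normcC (x : R) : 0 <= x -> normc x%:C = x.
  by move=> x0; rewrite /normc/= expr0n/= addr0 sqrtr_sqr ger0_norm.
pose h k : R[i] := (normc (f k) + normc (g k))%:C.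
have hE k : normc (h k) = normc (f k) + normc (g k).
  by rewrite normcC// addr_ge0 ?normc_ge0.
apply: (@le_trans _ _ (lpnorm p h)).
  by apply: le_lpnorm => // k; rewrite hE le_normcD.
rewrite [X in (X <= _)%E](@eq_Lnorm _ _ _ _ _ _
  (EFin \o ((@normc R \o f) \+ (@normc R \o g)))); last first.
  by move=> k; congr EFin; exact: hE.
exact: minkowski_EFin.
Qed.

Lemma lpnormZ p (a : R[i]) f : 0 < p ->
  lpnorm p (a *: f) = ((normc a)%:E * lpnorm p f)%E.
Proof.
move=> p0; rewrite !lpnormE//.
have s0 : (0 <= \sum_(k <oo) (normc (f k) `^ p)%:E)%E.
  by apply: nneseries_ge0 => k _ _; rewrite lee_fin powR_ge0.
have -> : (\sum_(k <oo) (normc ((a *: f) k) `^ p)%:E =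
           (normc a `^ p)%:E * \sum_(k <oo) (normc (f k) `^ p)%:E)%E.
  rewrite -nneseriesZl//; last by move=> k _; rewrite lee_fin powR_ge0.
  apply: eq_eseriesr => k _; rewrite -EFinM -powRM ?normc_ge0//.
  by rewrite -normcM.
rewrite poweRM ?lee_fin ?powR_ge0//.
by rewrite poweR_EFin -powRrM mulfV ?gt_eqF// powRr1// normc_ge0.
Qed.

Lemma lpnorm_eq0 p f : 0 < p -> lpnorm p f = 0%E -> f = 0.
Proof.
move=> p0; rewrite lpnormE// => /poweR_eq0_eq0.
have h k : (0 <= (normc (f k) `^ p)%:E)%E by rewrite lee_fin powR_ge0.
move=> /(_ (nneseries_ge0 (fun k _ _ => h k))) s0.
apply/funext => k; apply: eq0_normc; apply: (@powR_eq0_eq0 _ _ p).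
apply/eqP; rewrite eq_le powR_ge0 andbT -lee_fin -[leRHS]s0.
apply: (le_trans _ (nneseries_lim_ge k.+1 (fun i _ _ => h i))).
by rewrite big_nat_recr//= leeDr// sume_ge0.
Qed.

End lpnorm.

Definition lp_pred (R : realType) (p : R) (p1 : 1 <= p) : {pred nat -> R[i]} :=
  [pred f | `[< lpnorm p f < +oo >]%E].

Section lp_pred.
Context (R : realType) (p : R) (p1 : 1 <= p).

Let p0 : 0 < p. Proof. exact: lt_le_trans p1. Qed.

Lemma lp_predE f : (f \in lp_pred p1) = (lpnorm p f < +oo)%E.
Proof. by rewrite inE/= asboolb. Qed.

Lemma lp_submod_closed : submod_closed (lp_pred p1).
Proof.
split=> [|a f g]; rewrite !lp_predE ?lpnorm0// => fp gp.
rewrite (le_lt_trans (lpnormD _ _ p1))// lte_add_pinfty//.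
by rewrite lpnormZ// lte_mul_pinfty// lee_fin normc_ge0.
Qed.

HB.instance Definition _ :=
  GRing.isSubmodClosed.Build _ _ (lp_pred p1) lp_submod_closed.

End lp_pred.

Record lp (R : realType) (p : R) (p1 : 1 <= p) :=
  Lp { lp_fun :> nat -> R[i]; lp_funP : lp_fun \in lp_pred p1 }.

Section lp_space.
Context (R : realType) (p : R) (p1 : 1 <= p).

Let p0 : 0 < p. Proof. exact: lt_le_trans p1. Qed.

HB.instance Definition _ := [isSub for @lp_fun R p p1].
HB.instance Definition _ := [Choice of lp p1 by <:].
HB.instance Definition _ := [SubChoice_isSubLmodule of lp p1 by <:].

Definition lp_norm (f : lp p1) : R := fine (lpnorm p f).

Lemma lp_normE (f : lp p1) : (lp_norm f)%:E = lpnorm p f.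
Proof.
by rewrite fineK// ge0_fin_numE ?lpnorm_ge0// -(lp_predE p1) lp_funP.
Qed.

Lemma lp_norm_ge0 f : 0 <= lp_norm f.
Proof. by rewrite fine_ge0// lpnorm_ge0. Qed.

Let ler_lp_normD (f g : lp p1) :
  (lp_norm (f + g))%:C <= (lp_norm f)%:C + (lp_norm g)%:C.
Proof. by rewrite -rmorphD lecR -lee_fin EFinD !lp_normE lpnormD. Qed.

Let lp_normZ (a : R[i]) (f : lp p1) :
  (lp_norm (a *: f))%:C = `|a| * (lp_norm f)%:C.
Proof.
rewrite normcE -rmorphM; congr _%:C; apply: EFin_inj.
by rewrite EFinM !lp_normE -lpnormZ.
Qed.

Let lp_norm_eq0 (f : lp p1) : (lp_norm f)%:C = 0 -> f = 0.
Proof.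
move=> /complexI f0; apply/val_inj/(lpnorm_eq0 p0).
by rewrite -lp_normE f0.
Qed.

HB.instance Definition _ := Lmodule_isNormed.Build R[i] (lp p1)
  ler_lp_normD lp_normZ lp_norm_eq0.

Lemma normr_lpE (f : lp p1) : `|f| = (lp_norm f)%:C.
Proof. by []. Qed.

Lemma lp_restrict_subproof (X : set nat) (f : lp p1) :
  patch (fun=> 0) X f \in lp_pred p1.
Proof.
rewrite lp_predE; apply: (@le_lt_trans _ _ (lpnorm p f)); last first.
  by rewrite -(lp_predE p1) lp_funP.
by apply: le_lpnorm => // k; rewrite /patch; case: ifP; rewrite ?normc0 ?normc_ge0.
Qed.

(* f * \chi_X *)
Definition lp_restrict (X : set nat) (f : lp p1) : lp p1 :=
  Lp (lp_restrict_subproof X f).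

End lp_space.

(* For 1 <= p, q and 0 < n both norms below are finite (they are at most
   \sum_i `|f_i|), so taking the suprema in \bar R loses nothing. *)

Section standard_multinorm.
Context (R : realType) (p : R) (p1 : 1 <= p).

(* blocks may be empty, unlike with [partition] *)
Definition ordered_partition n : set ('I_n -> set nat) :=
  [set X | trivIset setT X /\ \bigcup_i X i = setT].

Definition std_norm (q : R) n (f : 'I_n -> lp p1) : \bar R :=
  ereal_sup
    [set ((\sum_(i < n) lp_norm (lp_restrict (X i) (f i)) `^ q) `^ q^-1)%:E
    | X in @ordered_partition n].

End standard_multinorm.

Section pq_multinorm.
Context (R : realType) (E : normedModType R[i]).

Definition mu_norm (p : R) n (l : 'I_n -> {linear E -> R[i]^o}) : \bar R :=
  ereal_sup
    [set ((\sum_(j < n) normc (l j x) `^ p) `^ p^-1)%:E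
    | x in [set x : E | `|x| <= 1]].

Definition pq_norm (p q : R) n (x : 'I_n -> E) : \bar R :=
  ereal_sup
    [set ((\sum_(i < n) normc (l i (x i)) `^ q) `^ q^-1)%:E
    | l in [set l : 'I_n -> {linear E -> R[i]^o} |
        (forall i, continuous (l i)) /\ (mu_norm p l <= 1)%E]].

End pq_multinorm.

(* Only n >= 1 is considered: for n = 0 there is no ordered partition of nat, so
   that [std_norm] would be the supremum of the empty set. *)
Definition multinorm_equiv (R : realType) (E : normedModType R[i])
    (N1 N2 : forall n, ('I_n -> E) -> \bar R) : Prop :=
  exists2 C : R, 0 < C & forall n (x : 'I_n -> E), (0 < n)%N ->
    (N1 n x <= C%:E * N2 n x)%E /\ (N2 n x <= C%:E * N1 n x)%E.

(* Main.v *)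
Require Import Defs.
From HB Require Import structures.
From mathcomp Require Import all_boot all_order all_algebra.
From mathcomp Require Import all_classical all_reals all_analysis.
From mathcomp Require Import complex ring lra.

(* Let N = 2^k and let f_i be the i-th row of the N x N Walsh matrix H, whose
   entries are 1 and -1 and which satisfies H^T H = N.  Since all entries have
   modulus 1 and q >= p, the standard q-multi-norm of (f_i) is at most N^(1/p).
   Parseval and the power mean inequality bound the norm of H on l^p_N by N^(b/p)
   with b = max(1, p - 1), so testing against the functionals N^(-b/p) f_i shows
   that the (p,q)-multi-norm is at least N^(1/q + 1 - b/p).  The quotient is at
   least N^e with e = 1/q if p >= 2 and e = 1/q + 1 - 2/p if p <= 2, and the
   hypothesis says exactly that e > 0. *)

Set Implicit Arguments.
Unset Strict Implicit.
Unset Printing Implicit Defensive.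

Import Order.TTheory GRing.Theory Num.Theory ComplexField.Normc.

Local Open Scope complex_scope.
Local Open Scope ring_scope.

(** * Two power-sum inequalities for exponents at least 1 *)

Section powR_sums.
Context {R : realType}.
Implicit Types r : R.

(** With S the sum of the [a i], each (a i)^r = a i * (a i)^(r-1) is at most a i * S^(r-1); add
    these up. *)
Lemma sum_powR_le_powR_sum r n (a : 'I_n -> R) : 1 <= r ->
  (forall i, 0 <= a i) -> \sum_(i < n) a i `^ r <= (\sum_(i < n) a i) `^ r.
Proof.
move=> r1 a0; have r0 : 0 < r by apply: lt_le_trans r1.
have s0 : 0 <= \sum_(i < n) a i by apply: sumr_ge0.
rewrite -mulr_powRB1// mulr_suml; apply: ler_sum => i _.
rewrite -mulr_powRB1//; apply: ler_wpM2l => //.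
apply: ge0_ler_powR; rewrite ?nnegrE ?subr_ge0//.
by rewrite (bigD1 i)//= lerDl sumr_ge0.
Qed.

Lemma power_mean r n (a : 'I_n -> R) : 1 <= r -> (forall i, 0 <= a i) ->
  (\sum_(i < n) a i) `^ r <= n%:R `^ (r - 1) * \sum_(i < n) a i `^ r.
Proof.
move=> r1 a0; have r0 : 0 < r by apply: lt_le_trans r1.
case: n a a0 => [|n] a a0; first by rewrite !big_ord0 mulr0 powR0// gt_eqF.
(* The case r = 1 is separate because the conjugate exponent [s] divides by r - 1. *)
move: r1; rewrite le_eqVlt => /predU1P[<-|r1].
  rewrite subrr powRr0 mul1r powRr1 ?sumr_ge0//.
  by apply: ler_sum => i _; rewrite powRr1.
set S := \sum_(i < n.+1) a i; have S0 : 0 <= S by apply: sumr_ge0.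
(* Young's inequality is applied against the mean [m], since it is sharp when all the [a i] equal
   [m]. *)
pose m := S / n.+1%:R.
have m0 : 0 <= m by rewrite divr_ge0.
pose s := r / (r - 1).
have r10 : 0 < r - 1 by rewrite subr_gt0.
have s0 : 0 < s by rewrite divr_gt0.
have rs : r^-1 + s^-1 = 1.
  by rewrite /s invf_div; field; rewrite gt_eqF.
(* Young's inequality [a i * m^(r-1) <= (a i)^r / r + m^r / s], summed over i *)
have young : \sum_(i < n.+1) a i * m `^ (r - 1) <=
    \sum_(i < n.+1) (a i `^ r / r + m `^ r / s).
  apply: ler_sum => i _.
  have := conjugate_powR (a0 i) (powR_ge0 m (r - 1)) r0 s0 rs.
  by rewrite -powRrM /s mulrCA mulfV ?gt_eqF// mulr1.
move: young; rewrite -mulr_suml big_split/= -mulr_suml sumr_const card_ord -/S.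
have Sm : S = n.+1%:R * m by rewrite /m mulrCA mulfV ?mulr1// pnatr_eq0.
rewrite Sm -mulrA mulr_powRB1// powRM// -[n.+1%:R `^ r]mulr_powRB1// -mulr_natl.
have -> : s^-1 = 1 - r^-1 by rewrite -rs addrC addKr.
set M := m `^ r; set A := \sum_(i < _) _ => h.
(* After cancelling the common power of n + 1, the goal (n + 1) * M <= A follows from [h] by
   collecting the terms in [M]. *)
rewrite mulrAC mulrC ler_wpM2l ?powR_ge0//.
rewrite -(ler_pM2r (x := r^-1)) ?invr_gt0//; lra.
Qed.

End powR_sums.

(** * Walsh matrices and Parseval's identity *)

Section walsh.
Context {R : realType}.

(** Parity of the number of positions among the lowest k binary digits where i and j both have a 1.
    Taking naturals as indices lets the recursion halve them freely. *)
Fixpoint walsh_sign k i j : bool :=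
  if k is k'.+1 then (odd i && odd j) (+) walsh_sign k' i./2 j./2 else false.

Definition walsh k i j : R[i] := (-1) ^+ walsh_sign k i j.

Lemma walsh_sqr k i j : walsh k i j * walsh k i j = 1.
Proof. by rewrite -expr2 sqrr_sign. Qed.

Lemma normc_walsh k i j : normc (walsh k i j) = 1.
Proof.
by apply: complexI; rewrite -Defs.normcE normrX normrN1 expr1n.
Qed.

Lemma sum_double (V : nmodType) n (F : nat -> V) :
  \sum_(i < n.*2) F i = \sum_(i < n) (F i.*2 + F i.*2.+1).
Proof.
elim: n => [|n IHn]; first by rewrite !big_ord0.
by rewrite doubleS !big_ord_recr/= IHn addrA.
Qed.

Lemma normc_parallelogram (a b : R[i]) :
  normc (a + b) ^+ 2 + normc (a - b) ^+ 2 = 2 * (normc a ^+ 2 + normc b ^+ 2).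
Proof.
case: a b => [a1 a2] [b1 b2] /=.
by rewrite !sqr_sqrtr ?addr_ge0 ?sqr_ge0//; ring.
Qed.

(** Induction on k, splitting rows and columns by parity: if u and v are the order 2^k transforms of
    the even and odd entries of [x], then rows 2i and 2i + 1 give u_i + v_i and u_i - v_i, and the
    parallelogram law supplies the factor 2. *)
Lemma walsh_parseval k (x : nat -> R[i]) :
  \sum_(i < 2 ^ k) normc (\sum_(j < 2 ^ k) walsh k i j * x j) ^+ 2 =
  (2 ^ k)%:R * \sum_(j < 2 ^ k) normc (x j) ^+ 2.
Proof.
elim: k x => [|k IHk] x.
  by rewrite expn0 !big_ord1 mul1r /walsh/= mul1r.
rewrite expnS mul2n.
rewrite (sum_double _
  (fun i => normc (\sum_(j < _) walsh k.+1 i j * x j) ^+ 2)).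
rewrite (sum_double _ (fun j => normc (x j) ^+ 2)).
have walshE i (b : bool) :
    \sum_(j < (2 ^ k).*2) walsh k.+1 (b + i.*2) j * x j =
    (\sum_(j < 2 ^ k) walsh k i j * x j.*2) +
    (-1) ^+ b * (\sum_(j < 2 ^ k) walsh k i j * x j.*2.+1).
  rewrite (sum_double _ (fun j => walsh k.+1 (b + i.*2) j * x j)).
  rewrite big_split/= mulr_sumr; congr (_ + _); apply: eq_bigr => j _.
    by rewrite /walsh/= !oddD !odd_double/= half_bit_double doubleK addbF andbF.
  rewrite /walsh/= !oddD !odd_double/= half_bit_double uphalf_double addbF.
  rewrite andbT.
  by rewrite signr_addb oddb -mulrA.
under eq_bigr => i _.
  rewrite (walshE i false) (walshE i true) expr0 expr1 mul1r mulN1r.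
  rewrite normc_parallelogram.
over.
rewrite -mulr_sumr big_split/=.
rewrite (IHk (fun j => x j.*2)) (IHk (fun j => x j.*2.+1)) -mulrDr -big_split/=.
by rewrite -[in RHS]mul2n natrM mulrA.
Qed.

End walsh.

(** * The norm of the Walsh matrix on finite-dimensional l^p *)

Section walsh_bound.
Context {R : realType}.
Implicit Types p : R.

Lemma powR_le_root (x y r : R) : 0 <= x -> 0 < r ->
  x `^ r <= y -> x <= y `^ r^-1.
Proof.
move=> x0 r0 xy; have y0 : 0 <= y by apply: le_trans xy; apply: powR_ge0.
rewrite -[leLHS](powRr1 x0) -(mulfV (lt0r_neq0 r0)) powRrM.
by apply: ge0_ler_powR; rewrite ?nnegrE ?powR_ge0 ?invr_ge0 ?(ltW r0).
Qed.

Lemma normc_walsh_sum_le k (x : nat -> R[i]) i :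
  normc (\sum_(j < 2 ^ k) walsh k i j * x j) <= \sum_(j < 2 ^ k) normc (x j).
Proof.
rewrite -lecR -Defs.normcE rmorph_sum (le_trans (ler_norm_sum _ _ _))//.
apply: ler_sum => j _.
by rewrite normrM !Defs.normcE normc_walsh mul1r.
Qed.

(** For y = Hx write |y_i|^p = |y_i|^(p-2) |y_i|^2. The first factor is bounded through the l^1 norm
    of x, the second is summed by Parseval, and power means compare both with the l^p norm of x. *)
Lemma walsh_bound_ge2 p k (x : nat -> R[i]) : 2 <= p ->
  \sum_(j < 2 ^ k) normc (x j) `^ p <= 1 ->
  \sum_(i < 2 ^ k) normc (\sum_(j < 2 ^ k) walsh k i j * x j) `^ p <=
  (2 ^ k)%:R `^ (p - 1).
Proof.
move=> p2 x1.
have p0 : 0 < p by apply: lt_le_trans p2.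
have pn0 : p != 0 by rewrite gt_eqF.
set N : R := (2 ^ k)%:R.
have N0 : N != 0 by rewrite pnatr_eq0 -lt0n expn_gt0.
have NE r s : N `^ r * N `^ s = N `^ (r + s).
  by rewrite powRD// N0 implybT.
have a0 (j : 'I_(2 ^ k)) : 0 <= normc (x j) by apply: normc_ge0.
set A := \sum_(j < 2 ^ k) normc (x j).
have A0 : 0 <= A by apply: sumr_ge0.
have AM : A <= N `^ ((p - 1) / p).
  rewrite powRrM; apply: powR_le_root => //.
  apply: (le_trans (power_mean _ a0)); first by rewrite (le_trans _ p2)// ler1n.
  by rewrite ler_piMr// powR_ge0.
have Q : \sum_(j < 2 ^ k) normc (x j) ^+ 2 <= N `^ (1 - 2 / p).
  (* This form of the exponent is what the power mean inequality yields for the |x_j|^2 with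
     exponent p/2. *)
  have -> : 1 - 2 / p = (p / 2 - 1) / (p / 2) by field.
  rewrite powRrM; apply: powR_le_root.
  - by apply: sumr_ge0 => j _; apply: sqr_ge0.
  - by rewrite divr_gt0.
  apply: (le_trans (power_mean _ _)).
  - by rewrite ler_pdivlMr ?mul1r.
  - by move=> j; apply: sqr_ge0.
  rewrite -[leRHS]mulr1; apply: ler_wpM2l; first exact: powR_ge0.
  apply: (le_trans _ x1); apply: ler_sum => j _.
  by rewrite -powR_mulrn// -powRrM mulrCA mulfV ?mulr1// pnatr_eq0.
pose y i := normc (\sum_(j < 2 ^ k) walsh k i j * x j).
have y0 i : 0 <= y i by apply: normc_ge0.
apply: (@le_trans _ _
    (\sum_(i < 2 ^ k) N `^ ((p - 1) / p * (p - 2)) * y i ^+ 2)).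
  apply: ler_sum => i _; rewrite -/(y i).
  have {1}-> : p = (p - 2) + 2 by rewrite subrK.
  rewrite powRD ?subrK ?(negbTE pn0)// powR_mulrn//.
  apply: ler_wpM2r; first exact: sqr_ge0.
  rewrite powRrM; apply: ge0_ler_powR; rewrite ?nnegrE ?powR_ge0 ?subr_ge0//.
  by apply: le_trans AM; apply: normc_walsh_sum_le.
rewrite -mulr_sumr walsh_parseval -/N.
have -> : N `^ (p - 1) = N `^ ((p - 1) / p * (p - 2)) * (N * N `^ (1 - 2 / p)).
  rewrite -[X in X * N `^ (1 - _)]powRr1 ?ler0n// !NE; congr (_ `^ _).
  by field.
by apply: ler_wpM2l; [exact: powR_ge0|exact: ler_wpM2l].
Qed.

(** The hypothesis forces every |x_j| <= 1, so the sum of the |x_j|^2 is also at most 1. Parseval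
    then bounds the l^2 norm of Hx, and the power mean inequality with exponent 2/p passes to
    l^p. *)
Lemma walsh_bound_le2 p k (x : nat -> R[i]) : 0 < p <= 2 ->
  \sum_(j < 2 ^ k) normc (x j) `^ p <= 1 ->
  \sum_(i < 2 ^ k) normc (\sum_(j < 2 ^ k) walsh k i j * x j) `^ p <=
  (2 ^ k)%:R.
Proof.
move=> /andP[p0 p2] x1.
set N : R := (2 ^ k)%:R.
have N0 : 0 < N by rewrite ltr0n expn_gt0.
have Q : \sum_(j < 2 ^ k) normc (x j) ^+ 2 <= 1.
  apply: (le_trans _ x1); apply: ler_sum => j _.
  have xj1 : normc (x j) <= 1.
    rewrite leNgt; apply/negP => xj1.
    have : 1 < \sum_(j < 2 ^ k) normc (x j) `^ p.
      rewrite (bigD1 j)//= ltr_wpDr//.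
        by apply: sumr_ge0 => *; apply: powR_ge0.
      have := gt0_ltr_powR p0 _ _ xj1; rewrite powR1.
      by apply; rewrite nnegrE ?normc_ge0.
    by rewrite ltNge x1.
  have [->|xj0] := eqVneq (normc (x j)) 0; first by rewrite expr0n powR_ge0.
  rewrite -powR_mulrn ?normc_ge0//; apply: ger_powR => //.
  by rewrite lt_neqAle eq_sym xj0 normc_ge0.
have -> : N = (N `^ (2 / p)) `^ (2 / p)^-1.
  by rewrite -powRrM mulfV ?powRr1 ?ltW// gt_eqF// divr_gt0.
apply: powR_le_root.
- by apply: sumr_ge0 => *; apply: powR_ge0.
- by rewrite divr_gt0.
apply: (le_trans (power_mean _ _)).
- by rewrite ler_pdivlMr ?mul1r.
- by move=> i; apply: powR_ge0.
under eq_bigr => i _.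
  rewrite -powRrM mulrCA mulfV ?gt_eqF// mulr1 powR_mulrn ?normc_ge0//.
over.
rewrite walsh_parseval -/N -[leRHS]mulr_powRB1 ?divr_gt0 ?(ltW N0)// mulrC.
by apply: ler_wpM2r; rewrite ?powR_ge0// ler_piMr// ltW//.
Qed.

Lemma walsh_bound p k (x : nat -> R[i]) : 0 < p ->
  \sum_(j < 2 ^ k) normc (x j) `^ p <= 1 ->
  \sum_(i < 2 ^ k) normc (\sum_(j < 2 ^ k) walsh k i j * x j) `^ p <=
  (2 ^ k)%:R `^ Num.max 1 (p - 1).
Proof.
move=> p0 x1; have N1 : 1 <= (2 ^ k)%:R :> R by rewrite ler1n expn_gt0.
have [p2|/ltW p2] := leP p 2.
  rewrite (le_trans (walsh_bound_le2 _ x1)) ?p0//.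
  by rewrite le1r_powR// le_max lexx.
by rewrite (le_trans (walsh_bound_ge2 p2 x1))// ler_powR// le_max lexx orbT.
Qed.

End walsh_bound.

(** * Coordinates, finitely supported sequences and their functionals on l^p *)

Section lp_coordinates.
Context {R : realType} {p : R} {p1 : 1 <= p}.

Let p0 : 0 < p. Proof. exact: lt_le_trans p1. Qed.

Lemma lpnorm_finite_support n (f : nat -> R[i]) :
  (forall k, (n <= k)%N -> f k = 0) ->
  lpnorm p f = ((\sum_(j < n) normc (f j) `^ p) `^ p^-1)%:E.
Proof.
move=> f0; rewrite lpnormE// (nneseries_split 0 n); last first.
  by move=> k _; rewrite lee_fin powR_ge0.
rewrite add0n eseries0 ?adde0; last first.
  by move=> k nk _; rewrite f0// normc0 powR0// gt_eqF.
by rewrite sumEFin big_mkord poweR_EFin.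
Qed.

Lemma lp_sum_le n (f : lp p1) :
  \sum_(j < n) normc (f j) `^ p <= lp_norm f `^ p.
Proof.
rewrite -lee_fin -poweR_EFin lp_normE lpnormE// -poweRrM mulVf ?gt_eqF//.
rewrite poweRe1; last by apply: nneseries_ge0 => *; rewrite lee_fin powR_ge0.
rewrite -sumEFin -(big_mkord xpredT (fun j => (normc (f j) `^ p)%:E)).
by apply: nneseries_lim_ge => *; rewrite lee_fin powR_ge0.
Qed.

Lemma normc_lp_le k (f : lp p1) : normc (f k) <= lp_norm f.
Proof.
rewrite -(powRr1 (normc_ge0 _)) -(powRr1 (lp_norm_ge0 _)).
rewrite -(mulfV (lt0r_neq0 p0)) !powRrM.
apply: ge0_ler_powR; rewrite ?nnegrE ?powR_ge0 ?invr_ge0 ?(ltW p0)//.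
apply: le_trans (lp_sum_le k.+1 f).
by rewrite big_ord_recr/= lerDr sumr_ge0// => *; apply: powR_ge0.
Qed.

Definition truncate n (a : nat -> R[i]) k := if (k < n)%N then a k else 0.

Lemma truncate_in_lp n a : truncate n a \in lp_pred p1.
Proof.
rewrite lp_predE (@lpnorm_finite_support n) ?ltry// => k nk.
by rewrite /truncate ltnNge nk.
Qed.

Definition lp_truncate n a : lp p1 := Lp (truncate_in_lp n a).

Definition pairing n (a : nat -> R[i]) (g : lp p1) : R[i]^o :=
  \sum_(j < n) a j * g j.

Fact pairing_is_linear n a : linear (pairing n a).
Proof.
move=> c f g; rewrite /pairing scaler_sumr -big_split/=; apply: eq_bigr => j _.
by rewrite mulrDr mulrCA.
Qed.

HB.instance Definition _ n a :=
  GRing.isLinear.Build R[i] (lp p1) R[i]^o *:%R (pairing n a)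
    (pairing_is_linear n a).

(** Coordinates are bounded by the norm, so the sum of the |a_j| is a bound for the functional. *)
Lemma pairing_continuous n a : continuous (pairing n a).
Proof.
apply: bounded_linear_continuous; apply/linear_boundedP; near=> r => g.
apply: (@le_trans _ _ ((\sum_(j < n) `|a j|) * `|g|)).
  rewrite mulr_suml (le_trans (ler_norm_sum _ _ _))//; apply: ler_sum => j _.
  rewrite normrM ler_wpM2l// normr_lpE [leLHS]Defs.normcE lecR.
  exact: normc_lp_le.
apply: ler_wpM2r => //.
by near: r; apply: nbhs_pinfty_ge; rewrite ger0_real// sumr_ge0.
Unshelve. all: by end_near. Qed.

End lp_coordinates.

(** * The two multi-norms of the Walsh rows *)

Section walsh_multinorms.
Context {R : realType} {p : R} {p1 : 1 <= p}.
Implicit Types q : R.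

Let p0 : 0 < p. Proof. exact: lt_le_trans p1. Qed.

Let walsh_row k (i : 'I_(2 ^ k)) : lp p1 := lp_truncate (2 ^ k) (walsh k i).

(** All entries of the row have modulus 1, so only the number of its positions lying in [X]
    matters. *)
Lemma lp_norm_restrict_walsh k X i :
  lp_norm (lp_restrict X (@walsh_row k i)) =
  (\sum_(j < 2 ^ k) (nat_of_ord j \in X)%:R) `^ p^-1.
Proof.
rewrite /lp_norm (@lpnorm_finite_support _ _ p1 (2 ^ k)) => [|j kj]; last first.
  by rewrite /= /patch /= /truncate ltnNge kj if_same.
rewrite /=; congr (_ `^ _); apply: eq_bigr => j _.
rewrite /patch /= /truncate ltn_ord; case: ifP => _.
  by rewrite normc_walsh powR1.
by rewrite normc0 powR0// gt_eqF.
Qed.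

(** The blocks of a partition split the N = 2^k positions into counts c_i with sum N. As q/p >= 1,
    the sum of the c_i^(q/p) is at most N^(q/p). *)
Lemma std_norm_walsh_le q k : p <= q ->
  (std_norm q (@walsh_row k) <= ((2 ^ k)%:R `^ p^-1)%:E)%E.
Proof.
move=> pq; have q0 : 0 < q by apply: lt_le_trans pq.
apply: ge_ereal_sup => _ [X [tX cX] <-]; rewrite lee_fin.
pose c i : R := \sum_(j < 2 ^ k) (nat_of_ord j \in X i)%:R.
have c0 i : 0 <= c i by apply: sumr_ge0.
have sc : \sum_(i < 2 ^ k) c i = (2 ^ k)%:R.
  rewrite exchange_big/= -[in RHS](card_ord (2 ^ k)) -sumr_const.
  apply: eq_bigr => j _.
  have [i _ ji] : (\bigcup_i X i)%classic (nat_of_ord j) by rewrite cX.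
  rewrite (bigD1 i)//= (mem_set ji) big1 ?addr0// => i' /eqP i'i.
  rewrite memNset// => ji'; apply: i'i.
  by apply: (tX i' i) => //; exists (nat_of_ord j).
under eq_bigr => i _ do rewrite lp_norm_restrict_walsh -powRrM -/(c i).
have -> : (2 ^ k)%:R `^ p^-1 = ((2 ^ k)%:R `^ (p^-1 * q)) `^ q^-1 :> R.
  by rewrite -powRrM mulfK// gt_eqF.
apply: ge0_ler_powR; rewrite ?invr_ge0 ?(ltW q0) ?nnegrE ?powR_ge0 ?sumr_ge0//.
  by move=> *; apply: powR_ge0.
by rewrite -sc sum_powR_le_powR_sum// mulrC ler_pdivlMr ?mul1r.
Qed.

(* the functionals are the rows themselves, divided by (a bound for) the norm of
   the Walsh matrix as an operator on [lp] *)
Lemma pq_norm_walsh_ge q k : 0 < q ->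
  (((2 ^ k)%:R `^ (q^-1 + 1 - Num.max 1 (p - 1) / p))%:E <=
   pq_norm p q (@walsh_row k))%E.
Proof.
move=> q0; set b := Num.max 1 _.
set N : R := (2 ^ k)%:R; have N0 : 0 < N by rewrite ltr0n expn_gt0.
pose c := N `^ (- b / p).
have c0 : 0 <= c by apply: powR_ge0.
have normcC : normc c%:C = c.
  by apply: complexI; rewrite -Defs.normcE ger0_norm// lecR.
pose l (i : 'I_(2 ^ k)) : {linear lp p1 -> R[i]^o} :=
  pairing (2 ^ k) (fun j => c%:C * walsh k i j).
have lE i g : normc (l i g) =
    c * normc (\sum_(j < 2 ^ k) walsh k i j * (g : lp p1) j).
  rewrite -[X in X * _]normcC -normcM mulr_sumr; congr normc.
  by apply: eq_bigr => j _; rewrite mulrA.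
apply: ereal_sup_ge; exists ((\sum_(i < 2 ^ k)
    normc (l i (@walsh_row k i)) `^ q) `^ q^-1)%:E.
  exists l => //; split=> [i|]; first exact: pairing_continuous.
  apply: ge_ereal_sup => _ [x /= x1 <-]; rewrite lee_fin.
  have one r : 1 = 1 `^ r :> R by rewrite powR1.
  rewrite [leRHS](one p^-1); apply: ge0_ler_powR.
  - by rewrite invr_ge0 ltW.
  - by rewrite nnegrE sumr_ge0// => *; apply: powR_ge0.
  - by rewrite nnegrE ler01.
  (* Homogeneity takes out c^p = N^(-b), which cancels the bound N^b on the Walsh transform of
     [x]. *)
  under eq_bigr => i _ do rewrite lE powRM ?normc_ge0//.
  rewrite -mulr_sumr /c -powRrM divfK ?gt_eqF// powRN.
  rewrite mulrC ler_pdivrMr ?powR_gt0// mul1r; apply: walsh_bound => //.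
  apply: le_trans (lp_sum_le _ _) _; rewrite [leRHS](one p).
  apply: ge0_ler_powR; rewrite ?(ltW p0) ?nnegrE ?lp_norm_ge0//.
  by move: x1; rewrite normr_lpE lecR.
rewrite lee_fin.
(* A row paired with itself is a sum of N squares of signs, so all N terms of the q-sum equal (c
   N)^q. *)
have lw (i : 'I_(2 ^ k)) : normc (l i (@walsh_row k i)) = c * N.
  rewrite lE; congr (_ * _).
  have -> : \sum_(j < 2 ^ k) walsh k i j * @walsh_row k i j = N%:C.
    transitivity (\sum_(j < 2 ^ k) (1 : R[i])).
      by apply: eq_bigr => j _; rewrite /= /truncate ltn_ord walsh_sqr.
    by rewrite sumr_const card_ord rmorph_nat.
  by apply: complexI; rewrite -Defs.normcE ger0_norm// lecR ltW.
under eq_bigr => i _ do rewrite lw.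
rewrite sumr_const card_ord -mulr_natl -/N powRM ?powR_ge0 ?(ltW N0)//.
rewrite -powRrM mulfV ?gt_eqF// powRr1 ?mulr_ge0 ?(ltW N0)//.
rewrite /c -[X in _ * (_ * X)](powRr1 (ltW N0)) -!powRD ?(gt_eqF N0) ?implybT//.
by rewrite le_eqVlt; apply/orP; left; apply/eqP; congr (_ `^ _); ring.
Qed.

End walsh_multinorms.

(** * Comparison of the two growth rates *)

Theorem theorem4p27 (R : realType) (p q : R) (p_gt1 : 1 < p) (le_pq : p <= q)
  (hpq : 2 <= p <= q \/ 1 < p < 2 /\ p <= q < p / (2 - p)) :
  ~ multinorm_equiv (fun n => @std_norm R p (ltW p_gt1) q n)
                    (fun n => @pq_norm R (lp (ltW p_gt1)) p q n).
Proof.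
case=> C C0 equivC.
have p0 : 0 < p by apply: (lt_trans _ p_gt1).
have q0 : 0 < q by apply: (lt_le_trans p0).
(* The exponent of the lower bound for the (p,q)-multi-norm minus the exponent 1/p of the upper
   bound for the standard one. *)
pose e := q^-1 + 1 - Num.max 1 (p - 1) / p - p^-1.
have e0 : 0 < e.
  case: hpq => [/andP[p2 _]|[/andP[_ p2] /andP[_ qlt]]].
    rewrite /e max_r ?lerBrDr//.
    have -> : q^-1 + 1 - (p - 1) / p - p^-1 = q^-1.
      by field; rewrite !gt_eqF.
    by rewrite invr_gt0.
  rewrite /e max_l; last by rewrite lerBlDr ltW.
  (* Multiplied by p q, positivity of [e] becomes q (2 - p) < p, which is the assumed bound on q. *)
  rewrite -(pmulr_rgt0 _ (mulr_gt0 p0 q0)).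
  have -> : p * q * (q^-1 + 1 - 1 / p - p^-1) = p - q * (2 - p).
    by field; rewrite !gt_eqF.
  by rewrite subr_gt0 -ltr_pdivlMr// subr_gt0.
have bound k : (2 ^ k)%:R `^ e <= C.
  have N0 : 0 < (2 ^ k)%:R :> R by rewrite ltr0n expn_gt0.
  have [_] := equivC _
    (fun i : 'I_(2 ^ k) => lp_truncate (2 ^ k) (walsh k i)) (expn_gt0 2 k).
  move=> /(le_trans (pq_norm_walsh_ge k q0)).
  have /(lee_wpmul2l (ltW C0 : 0 <= C%:E)%E) :=
    std_norm_walsh_le (p1 := ltW p_gt1) k le_pq.
  move=> /[swap] /le_trans /[apply]; rewrite -EFinM lee_fin => h.
  by rewrite powRD ?(gt_eqF N0) ?implybT// powRN ler_pdivrMr ?powR_gt0.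
(* Such a k is contradictory: k <= 2^k, while [bound] gives 2^k <= C^(1/e). *)
have : exists k : nat, C `^ e^-1 < k%:R.
  by exists (Num.trunc (C `^ e^-1)).+1; apply: truncnS_gt.
case=> k; apply/negP; rewrite -leNgt.
apply: (@le_trans _ _ (2 ^ k)%:R); first by rewrite ler_nat ltnW// ltn_expl.
exact: powR_le_root.
Qed.
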